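(* Let $\mathcal{M}$ be a type ${\rm II}_1$ factor with a faithful normal trace $\tau$ and let $S,T\in\mathcal{M}$. If there is an operator $X\in\mathcal{M}$ such that $N(X)=0$ and $XS=TX$, then $Lat_{\mathcal{M}}\, S$ is isomorphic to a sublattice of $Lat_{\mathcal{M}}\, T$ and $Lat_{\mathcal{M}}\, T$ is isomorphic to a sublattice of $Lat_{\mathcal{M}}\, S$. In particular, $S$ has a nontrivial invariant subspace (relative to $\mathcal{M}$, i.e. $Lat_{\mathcal{M}}\,S\neq\{0,I\}$) if and only if $T$ has a nontrivial invariant subspace (relative to $\mathcal{M}$, i.e. $Lat_{\mathcal{M}}\,T\neq\{0,I\}$).
   Context: $\mathcal{M}$ acts on a Hilbert space $\mathcal{H}$. For $T\in\mathcal{M}$, $Lat_{\mathcal{M}}\,T$ denotes the set of projections $P\in\mathcal{M}$ such that $TP=PTP$, regarded as a lattice with the usual join $\vee$ and meet $\wedge$ of projections. $N(X)$ denotes the kernel of $X$ (identified with the projection onto it). Isomorphisms are lattice isomorphisms. *)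

(* Defs.v *)
From HB Require Import structures.
From mathcomp Require Import all_boot all_order all_algebra.
From mathcomp Require Import complex.
From mathcomp Require Import boolp classical_sets functions reals topology normedtype.

Set Implicit Arguments.
Unset Strict Implicit.
Unset Printing Implicit Defensive.

Import Order.TTheory GRing.Theory Num.Theory.
Import numFieldNormedType.Exports.

Local Open Scope classical_set_scope.
Local Open Scope ring_scope.
Local Open Scope complex_scope.

(* The inner product is linear in its first argument and conjugate-linear in
   the second; by completeness of the normed space, H is a Hilbert space. No
   separability is assumed. *)
HB.mixin Record CompleteNormedModule_isHilbert (R : realType) H
    of CompleteNormedModule R[i] H := {
  inner : {dot H for (@Num.conj R[i])} ;
  inner_norm : forall x : H, inner x x = `|x| ^+ 2
}.

#[short(type="hilbertType")]
HB.structure Definition Hilbert (R : realType) :=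
  { H of CompleteNormedModule_isHilbert R H & CompleteNormedModule R[i] H }.

Section Operators.
Context {R : realType} {H : hilbertType R}.
Implicit Types (A B P Q V : H -> H) (M L : set (H -> H)).

(* Operators are plain functions H -> H, so that their equality is pointwise;
   sums and scalar multiples are those of the function space. *)
Definition bounded_op A : Prop := linear A /\ continuous A.

(* B = A^*. For A in B(H) such a B exists, is unique, and is in B(H). *)
Definition is_adjoint A B : Prop := forall x y, inner (A x) y = inner x (B y).

Definition op_le A B : Prop := forall x, inner (A x) x <= inner (B x) x.

Definition is_proj P : Prop :=
  [/\ bounded_op P, P \o P = P & is_adjoint P P].

(* The projection onto the closed subspace K (and 0 if K is not one). *)
Definition proj_onto (K : set H) : H -> H :=
  xget (0 : H -> H) [set P | is_proj P /\ range P = K].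

Definition pmeet P Q : H -> H := proj_onto (range P `&` range Q).

Definition pjoin P Q : H -> H :=
  proj_onto (closure [set x + y | x in range P & y in range Q]).

Definition commutant M : set (H -> H) :=
  [set B | bounded_op B /\ forall A, M A -> A \o B = B \o A].

(* M = M'' and M = M^*; being a commutant, M is then a unital subalgebra of
   B(H), closed in the weak and strong operator topologies. *)
Record von_neumann_algebra M : Prop := {
  vna_star : forall A B, M A -> is_adjoint A B -> M B ;
  vna_bicommutant : commutant (commutant M) = M
}.

(* In the complex order 0 <= <A x, x> says that <A x, x> is real and
   nonnegative, so A is automatically self-adjoint. *)
Definition positive_part M : set (H -> H) := [set A | M A /\ op_le 0 A].

Definition projections M : set (H -> H) := [set P | M P /\ is_proj P].

Record factor M : Prop := {
  factor_vna : von_neumann_algebra M ;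
  factor_neq0 : (id : H -> H) <> 0 ;
  factor_center : M `&` commutant M = [set c *: (id : H -> H) | c in [set: R[i]]]
}.

(* Murray--von Neumann equivalence: V^* V = P and V V^* = Q with V in M. *)
Definition mvn_equiv M P Q : Prop :=
  exists V Vs, [/\ M V, is_adjoint V Vs, Vs \o V = P & V \o Vs = Q].

Definition finite_proj M P : Prop :=
  forall Q, projections M Q -> op_le Q P -> mvn_equiv M Q P -> Q = P.

Definition abelian_proj M P : Prop :=
  forall A B, M A -> M B ->
    (P \o A \o P) \o (P \o B \o P) = (P \o B \o P) \o (P \o A \o P).

Record type_II1_factor M : Prop := {
  II1_factor : factor M ;
  II1_no_abelian : forall P, projections M P -> abelian_proj M P -> P = 0 ;
  II1_finite : finite_proj M id
}.

Definition directed (D : set (H -> H)) : Prop :=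
  D !=set0 /\
  forall A B, D A -> D B -> exists E, [/\ D E, op_le A E & op_le B E].

(* A is the least upper bound of D in M_+. *)
Definition op_lub M (D : set (H -> H)) A : Prop :=
  [/\ positive_part M A, forall B, D B -> op_le B A &
    forall B, positive_part M B -> (forall E, D E -> op_le E B) -> op_le A B].

(* Only the values of tau on M matter. No normalization is imposed. *)
Record faithful_normal_trace M (tau : (H -> H) -> R[i]) : Prop := {
  trace_linear : forall (c : R[i]) A B, M A -> M B ->
    tau (c *: A + B) = c * tau A + tau B ;
  trace_ge0 : forall A, positive_part M A -> 0 <= tau A ;
  trace_comm : forall A B, M A -> M B -> tau (A \o B) = tau (B \o A) ;
  trace_faithful : forall A, positive_part M A -> tau A = 0 -> A = 0 ;
  trace_normal : forall (D : set (H -> H)) A,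
    D `<=` positive_part M -> directed D -> op_lub M D A ->
    supremums (tau @` D) (tau A)
}.

Definition Lat M (T : H -> H) : set (H -> H) :=
  [set P | projections M P /\ T \o P = P \o T \o P].

Definition sublattice L L' : Prop :=
  L `<=` L' /\ forall P Q, L P -> L Q -> L (pmeet P Q) /\ L (pjoin P Q).

Definition lattice_iso L L' (phi : (H -> H) -> (H -> H)) : Prop :=
  set_bij L L' phi /\
  forall P Q, L P -> L Q ->
    phi (pmeet P Q) = pmeet (phi P) (phi Q) /\
    phi (pjoin P Q) = pjoin (phi P) (phi Q).

Definition iso_to_sublattice L L' : Prop :=
  exists L0 phi, sublattice L0 L' /\ lattice_iso L L0 phi.

Definition kernel A : set H := [set x | A x = 0].

End Operators.

(* Main.v *)
Require Import Defs.
From HB Require Import structures.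
From mathcomp Require Import all_boot all_order all_algebra.
From mathcomp Require Import complex.
From mathcomp Require Import boolp classical_sets functions reals topology normedtype.
From mathcomp Require Import sequences ring lra.

(** Let [X] be injective with [X S = T X].  Two maps compare the lattices:
    [push_proj] sends a projection [P] to the projection onto the closure of
    [X (P H)], and [pull_proj] sends [Q] to the projection onto the inverse
    image of [Q H] under [X].  The intertwining relation makes them send
    invariant subspaces to invariant subspaces.  They form a Galois connection,
    so [push_proj] preserves joins and [pull_proj] preserves meets; what has to
    be shown is that each of them preserves the other operation as well and is
    injective.  In infinite dimension this fails for a general injective
    operator, and it is here that the trace enters.

    Both maps preserve the trace.  This rests on [trace_supports]: the
    projections onto the orthogonal complement of the kernel of [A] and onto
    the closure of its range have the same trace, for every [A] in the algebra.
    For [A = X] it shows that an injective [X] has dense range; for [A = X P] it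
    gives the trace of the push-forward, and for [A = (1 - Q) X] that of the
    pull-back.  For [A = (1 - Q) P] it is Kaplansky's formula
    [tau (P /\ Q) + tau (P \/ Q) = tau P + tau Q] ([trace_modular]).  By this
    formula a trace-preserving map that respects one lattice operation respects
    the trace of the other; since comparable projections of equal trace are
    equal ([proj_le_trace], from faithfulness), it respects the other operation
    and is injective ([trace_embedding]).

    The two supports are compared without polar decomposition.  Scale [A] to be
    a contraction with adjoint [B] and put [K = 1 - B A], [K' = 1 - A B].  The
    numbers [<K^n x, x>] decrease, which makes [K^n x] a Cauchy sequence; its
    limit is the projection onto the kernel of [A], and it lies in the algebra
    because a bicommutant is strongly closed.  Hence [1 - K^n] increases to the
    projection onto the orthogonal complement of the kernel of [A] and
    [1 - K'^n] to the projection onto the closure of its range.  Since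
    [1 - K^n = \sum_(k < n) B K'^k A], the trace property gives
    [tau (1 - K^n) = tau (1 - K'^n)], and normality passes to the limit.

    Adjoints of bounded operators are obtained from a Riesz representation
    theorem proved by minimisation ([riesz]). *)

Set Implicit Arguments.
Unset Strict Implicit.
Unset Printing Implicit Defensive.

Import Order.TTheory GRing.Theory Num.Theory.
Import numFieldNormedType.Exports.

Local Open Scope classical_set_scope.
Local Open Scope ring_scope.
Local Open Scope complex_scope.

Local Notation Re := complex.Re.
Local Notation Im := complex.Im.

(** * The inner product *)

Section InnerProduct.
Context {R : realType} {H : hilbertType R}.
Implicit Types (x y z : H) (c : R[i]).

Lemma innerDl z x y : inner (x + y) z = inner x z + inner y z.
Proof. exact: linearDl. Qed.

Lemma innerDr z x y : inner z (x + y) = inner z x + inner z y.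
Proof. exact: linearDr. Qed.

Lemma innerBl z x y : inner (x - y) z = inner x z - inner y z.
Proof. exact: linearBl. Qed.

Lemma innerBr z x y : inner z (x - y) = inner z x - inner z y.
Proof. exact: linearBr. Qed.

Lemma innerZl z c x : inner (c *: x) z = c * inner x z.
Proof. exact: linearZl_LR. Qed.

Lemma innerZr z c x : inner z (c *: x) = Num.conj c * inner z x.
Proof. exact: linearZr_LR. Qed.

Lemma inner0l z : inner (0 : H) z = 0.
Proof. exact: linear0l. Qed.

Lemma inner0r z : inner z (0 : H) = 0.
Proof. exact: linear0r. Qed.

Lemma innerC x y : inner x y = Num.conj (inner y x).
Proof. by rewrite hermC /= expr0 mul1r. Qed.

Lemma inner_ge0 x : 0 <= inner x x.
Proof. by rewrite inner_norm exprn_ge0. Qed.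

Lemma inner_eq0 x : inner x x = 0 -> x = 0.
Proof. by rewrite inner_norm => /eqP; rewrite sqrf_eq0 normr_eq0 => /eqP. Qed.

Lemma inner_inj x y : (forall z, inner x z = inner y z) -> x = y.
Proof.
move=> xy; apply/eqP; rewrite -subr_eq0; apply/eqP/inner_eq0.
by rewrite innerBl xy subrr.
Qed.

(** The residual of projecting [x] on the line of [y], cleared of denominators,
    has nonnegative square. *)
Lemma CauchySchwarz_inner x y : `|inner x y| <= `|x| * `|y|.
Proof.
have [->|y0] := eqVneq y 0; first by rewrite inner0r !normr0 mulr0.
have yy : 0 < inner y y by rewrite inner_norm exprn_gt0 // normr_gt0.
have := inner_ge0 (inner y y *: x - inner x y *: y).
rewrite innerBl !innerBr !innerZl !innerZr.
rewrite (geC0_conj (ltW yy)) (innerC y x).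
have -> : inner y y * (inner y y * inner x x)
   - inner y y * (Num.conj (inner x y) * inner x y) -
  (inner x y * (inner y y * Num.conj (inner x y)) -
   inner x y * (Num.conj (inner x y) * inner y y)) =
  inner y y * (inner x x * inner y y - inner x y * Num.conj (inner x y)) by ring.
rewrite pmulr_rge0 // -normCK subr_ge0 !inner_norm -exprMn.
by rewrite ler_sqr // nnegrE ?mulr_ge0.
Qed.

End InnerProduct.

Section RealInnerProduct.
Context {R : realType} {H : hilbertType R}.
Implicit Types (x y z : H).

(** The real inner product underlying [inner].  Estimates are carried out with it,
    in the totally ordered field [R]. *)
Definition rip x y : R := Re (inner x y).

Lemma ripC x y : rip x y = rip y x.
Proof. by rewrite /rip innerC; case: (inner y x). Qed.

Lemma ripDl z x y : rip (x + y) z = rip x z + rip y z.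
Proof. by rewrite /rip innerDl raddfD. Qed.

Lemma ripBl z x y : rip (x - y) z = rip x z - rip y z.
Proof. by rewrite /rip innerBl raddfB. Qed.

Lemma ripDr z x y : rip z (x + y) = rip z x + rip z y.
Proof. by rewrite /rip innerDr raddfD. Qed.

Lemma ripBr z x y : rip z (x - y) = rip z x - rip z y.
Proof. by rewrite /rip innerBr raddfB. Qed.

Lemma ReZ (t : R) (c : R[i]) : Re (t%:C * c) = t * Re c.
Proof. by case: c => a b /=; rewrite mul0r subr0. Qed.

Lemma ripZl z (t : R) x : rip (t%:C *: x) z = t * rip x z.
Proof. by rewrite /rip innerZl ReZ. Qed.

Lemma ripZr z (t : R) x : rip z (t%:C *: x) = t * rip z x.
Proof. by rewrite ripC ripZl ripC. Qed.

Lemma inner_rip x : inner x x = (rip x x)%:C.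
Proof. by rewrite RRe_real // ger0_real // inner_ge0. Qed.

Lemma rip_ge0 x : 0 <= rip x x.
Proof. by rewrite -ler0c -inner_rip inner_ge0. Qed.

Lemma rip_norm x : (rip x x)%:C = `|x| ^+ 2.
Proof. by rewrite -inner_rip inner_norm. Qed.

Lemma Im_inner x y : Im (inner x y) = rip ((- 'i) *: x) y.
Proof.
rewrite /rip innerZl; case: (inner x y) => a b /=.
by rewrite oppr0 mul0r sub0r mulN1r opprK.
Qed.

(** Polarisation: the imaginary part of [inner x y] is the real part at [- 'i x],
    so identities between inner products that are stable under scaling of the
    left argument can be checked on real parts. *)
Lemma inner_rip_inj (x x' y y' : H) :
  (forall c : R[i], rip (c *: x) y = rip (c *: x') y') ->
  inner x y = inner x' y'.
Proof.
move=> e; have := e 1; have := e (- 'i); rewrite !scale1r -!Im_inner /rip.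
by case: (inner x y) (inner x' y') => a b [a' b'] /= -> ->.
Qed.

Lemma rip_eq0 x : rip x x = 0 -> x = 0.
Proof. by move=> x0; apply: inner_eq0; rewrite inner_rip x0. Qed.

Lemma le_rip_norm x y : (`|rip x y|)%:C <= `|x| * `|y|.
Proof. exact: le_trans (normc_ge_Re _) (CauchySchwarz_inner x y). Qed.

Lemma cvg_rip (u : nat -> H) (l y : H) :
  u @ \oo --> l -> (rip (u n) y @[n --> \oo] --> rip l y).
Proof.
move=> ul; apply/cvgrPdist_lt => e e0 /=.
have e1 : 0 < e%:C / (1 + `|y|) :> R[i] by rewrite divr_gt0 ?ltcR // ltr_pwDl.
move/cvgrPdist_lt: ul => /(_ _ e1); apply: filterS => n un.
rewrite -ltcR -ripBl; apply: le_lt_trans (le_rip_norm _ _) _.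
rewrite -[ltRHS](@divfK _ (1 + `|y|)); last by rewrite gt_eqF // ltr_pwDl.
apply: (@le_lt_trans _ _ (`|l - u n| * (1 + `|y|))).
  by rewrite ler_wpM2l // lerDr.
by rewrite ltr_pM2r // ltr_pwDl.
Qed.

(** The Cauchy property is tested on squared norms, which are the quantities
    that the expansion of [rip] provides. *)
Lemma cauchy_rip_cvg (u : nat -> H) :
  (forall e : R, 0 < e -> exists N, forall n m, (N <= n)%N -> (N <= m)%N ->
     rip (u n - u m) (u n - u m) < e) ->
  exists l : H, u @ \oo --> l.
Proof.
move=> uC; apply/cvg_ex/cauchy_cvgP/cauchy_ballP => e e0; rewrite near_map2.
have [k ek] : exists k : R, e = k%:C.
  by apply/complex_realP; rewrite gtr0_real.
have k0 : 0 < k by rewrite -ltcR -ek.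
have [N uN] := uC _ (exprn_gt0 2 k0).
near=> n m => /=; rewrite -ball_normE /=.
rewrite -(@ltr_pXn2r _ 2) ?nnegrE ?(ltW e0) // -rip_norm ek -rmorphXn /= ltcR.
by apply: uN; [near: n|near: m]; exists N.
Unshelve. all: by end_near. Qed.

End RealInnerProduct.

(** * Bounded operators and adjoints *)

Section Operators.
Context {R : realType} {H : hilbertType R}.
Implicit Types (x y z : H) (A B C : H -> H).

Lemma op_linear A : bounded_op A -> forall c x y, A (c *: x + y) = c *: A x + A y.
Proof. by move=> [lA _] c x y; apply: lA. Qed.

Lemma opD A : bounded_op A -> forall x y, A (x + y) = A x + A y.
Proof. by move=> bA x y; rewrite -[x]scale1r (op_linear bA) !scale1r. Qed.

Lemma op0 A : bounded_op A -> A 0 = 0.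
Proof. by move=> bA; apply: (@addIr _ (A 0)); rewrite -(opD bA) !add0r. Qed.

Lemma opZ A : bounded_op A -> forall c x, A (c *: x) = c *: A x.
Proof. by move=> bA c x; rewrite -[c *: x]addr0 (op_linear bA) (op0 bA) addr0. Qed.

Lemma opB A : bounded_op A -> forall x y, A (x - y) = A x - A y.
Proof. by move=> bA x y; rewrite (opD bA) -scaleN1r (opZ bA) scaleN1r. Qed.

Lemma lim_unique (u : nat -> H) (a b : H) :
  u @ \oo --> a -> u @ \oo --> b -> a = b.
Proof. by move=> ua ub; apply: (cvg_unique _ ua ub). Qed.

Lemma op_cvg A (u : nat -> H) (l : H) :
  bounded_op A -> u @ \oo --> l -> A \o u @ \oo --> A l.
Proof. by move=> [_ cA] ul; apply: cvg_comp ul _; apply: cA. Qed.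

(** Young's inequality, a form of the Cauchy-Schwarz inequality free of square
    roots. *)
Lemma rip_young (s : R) x y :
  0 < s -> 2 * rip x y <= s * rip x x + s^-1 * rip y y.
Proof.
move=> s0; have := rip_ge0 (s%:C *: x - y).
rewrite !ripBl !ripBr !ripZl !ripZr (ripC y x) => h.
rewrite -(ler_pM2l s0) mulrDr [s * (s^-1 * _)]mulrA divff ?gt_eqF // mul1r.
lra.
Qed.

Lemma op_bound A : bounded_op A ->
  exists2 r : R, 0 < r & forall x, rip (A x) (A x) <= r * rip x x.
Proof.
move=> [lA cA].
pose f : {linear H -> H} := HB.pack A (GRing.isLinear.Build _ _ _ _ A lA).
have /linear_bounded_continuous/linear_boundedP/pinfty_ex_gt0[r r0 fr] :
  continuous f by [].
have [k rk] : exists k : R, r = k%:C by apply/complex_realP; rewrite gtr0_real.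
have k0 : 0 < k by rewrite -ltcR -rk.
exists (k ^+ 2) => [|x]; first exact: exprn_gt0.
rewrite -lecR rmorphM rmorphXn /= !rip_norm -rk -exprMn.
by rewrite ler_pXn2r ?nnegrE ?mulr_ge0 ?(ltW r0) //; apply: fr.
Qed.

Lemma bound_op A (r : R) : linear A ->
  (forall x, rip (A x) (A x) <= r * rip x x) -> bounded_op A.
Proof.
move=> lA Ar; split=> //.
pose f : {linear H -> H} := HB.pack A (GRing.isLinear.Build _ _ _ _ A lA).
apply: (@bounded_linear_continuous _ _ _ f); apply/linear_boundedP.
have k0 : 0 < (`|r| + 1)%:C :> R[i] by rewrite ltcR ltr_wpDl.
exists (`|r| + 1)%:C; split; first by rewrite gtr0_real.
move=> s ks x; have s0 := lt_trans k0 ks.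
rewrite -(@ler_pXn2r _ 2) ?nnegrE ?mulr_ge0 ?(ltW s0) //= exprMn.
apply: (@le_trans _ _ ((`|r| + 1)%:C ^+ 2 * `|x| ^+ 2)); last first.
  by rewrite ler_wpM2r ?exprn_ge0 // lerXn2r ?nnegrE ?(ltW s0) ?(ltW k0) ?ltW.
rewrite -!rip_norm -rmorphXn -rmorphM /= lecR (le_trans (Ar x)) //.
rewrite ler_wpM2r ?rip_ge0 // (le_trans (ler_norm r)) //.
have := normr_ge0 r; nra.
Qed.

(** Riesz representation over the reals: the representing vector is the
    minimiser of [rip x x - 2 * g x], which exists because the parallelogram
    identity makes minimising sequences Cauchy. *)
Lemma riesz (g : H -> R) (c : R) :
  (forall x y, g (x + y) = g x + g y) ->
  (forall (t : R) x, g (t%:C *: x) = t * g x) ->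
  (forall x, 2 * g x <= rip x x + c) ->
  exists z, forall x, g x = rip x z.
Proof.
move=> gD gZ gc.
pose J x := rip x x - 2 * g x.
have Jinf : has_inf (range J).
  split; first by exists (J 0), 0.
  by exists (- c) => _ [x _ <-]; rewrite /J; have := gc x; lra.
have Jm x : inf (range J) <= J x by apply: ge_inf; [case: Jinf|exists x].
set m := inf _ in Jm.
have Jn n : exists x, J x < m + n.+1%:R^-1.
  have n0 : 0 < n.+1%:R^-1 :> R by rewrite invr_gt0 ltr0n.
  have [_ [x _ <-] xm] := inf_adherent n0 Jinf.
  by exists x.
have [u uJ] := choice Jn.
have [z uz] : exists z : H, u @ \oo --> z.
  apply: cauchy_rip_cvg => e e0.
  have [N Ne] : exists N : nat, N.+1%:R^-1 < e / 4.
    have e4 : 0 < e / 4 by rewrite divr_gt0.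
    have /cvgrPdist_lt/(_ _ e4)[N _ /(_ N (leqnn N)) hN] := @cvg_harmonic R.
    by exists N; move: hN; rewrite /= sub0r normrN gtr0_norm // invr_gt0 ltr0n.
  exists N => n k Nn Nk.
  have un i : (N <= i)%N -> J (u i) < m + e / 4.
    move=> Ni; apply: lt_trans (uJ i) _; rewrite ltrD2l.
    apply: le_lt_trans Ne; rewrite lef_pV2 ?posrE ?ltr0n //.
    by rewrite ler_nat.
  have h1 := un _ Nn; have h2 := un _ Nk.
  (* The midpoint cannot go below the infimum, which bounds [u n - u k]. *)
  have h3 := Jm ((2^-1)%:C *: (u n + u k)); move: h1 h2 h3.
  rewrite /J gZ gD ripZl ripZr !ripBl !ripBr !ripDl !ripDr (ripC (u k) (u n)).
  lra.
exists z => v; apply/eqP; rewrite -subr_eq0; apply/eqP.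
(* First variation of [J] at the minimiser in the direction [v]. *)
have ge0 (t : R) : 0 <= 2 * t * (rip z v - g v) + t ^+ 2 * rip v v.
  have cv : (2 * t * (rip (u n) v - g v) + t ^+ 2 * rip v v + n.+1%:R^-1)
      @[n --> \oo] --> 2 * t * (rip z v - g v) + t ^+ 2 * rip v v + 0.
    apply: cvgD; last exact: cvg_harmonic.
    apply: cvgD; last exact: cvg_cst.
    apply: cvgMr; apply: cvgB; [exact: cvg_rip|exact: cvg_cst].
  rewrite -[leRHS]addr0 -(cvg_lim _ cv) //; apply: limr_ge.
    by apply/cvg_ex; eexists; exact: cv.
  apply: nearW => n; have := Jm (u n + t%:C *: v); have := uJ n.
  rewrite /J gD gZ !ripDl !ripDr !ripZl !ripZr (ripC v (u n)) => h1 h2.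
  rewrite -subr_ge0 in h2; apply: le_trans h2 _.
  rewrite -subr_ge0; rewrite -subr_gt0 in h1; apply: le_trans (ltW h1) _.
  by rewrite le_eqVlt; apply/orP; left; apply/eqP; ring.
set d := rip z v - g v in ge0; rewrite ripC.
have q0 : 0 < rip v v + 1 by rewrite ltr_wpDl ?rip_ge0.
(* The optimal step is [- d / rip v v]; the summand 1 covers [v = 0]. *)
have := ge0 (- d / (rip v v + 1)).
have -> : 2 * (- d / (rip v v + 1)) * d + (- d / (rip v v + 1)) ^+ 2 * rip v v
  = - (d ^+ 2 * ((rip v v + 2) / (rip v v + 1) ^+ 2)).
  by field; rewrite gt_eqF.
rewrite oppr_ge0 pmulr_lle0 => [d0|]; last first.
  by rewrite divr_gt0 ?exprn_gt0 // ltr_wpDl ?rip_ge0.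
have : d ^+ 2 = 0 by apply/eqP; rewrite eq_le d0 sqr_ge0.
by move/eqP; rewrite sqrf_eq0 /d => /eqP; lra.
Qed.

Lemma adjoint_bounded A B : bounded_op A -> is_adjoint A B -> bounded_op B.
Proof.
move=> bA AB; have [r r0 Ar] := op_bound bA.
apply: (@bound_op _ r).
  move=> c x y; apply: inner_inj => z; rewrite innerC -AB innerDr innerZr !AB.
  by rewrite -innerZr -innerDr -innerC.
move=> x; have := rip_young (A (B x)) x (s := r^-1).
rewrite {1}/rip AB invr_gt0 -/(rip _ _) invrK => /(_ r0) h.
have := Ar (B x); rewrite -ler_pdivrMl // => {}Ar; lra.
Qed.

Lemma adjoint_exists A : bounded_op A -> exists B, is_adjoint A B.
Proof.
move=> bA; have [r r0 Ar] := op_bound bA.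
suff /choice[B AB] : forall y, exists z, forall x, rip (A x) y = rip x z.
  by exists B => x y; apply: inner_rip_inj => c; rewrite -(opZ bA).
move=> y; apply: (@riesz (fun x => rip (A x) y) (r * rip y y)).
- by move=> x x'; rewrite (opD bA) ripDl.
- by move=> t x; rewrite (opZ bA) ripZl.
move=> x; have := rip_young (A x) y (s := r^-1).
rewrite invr_gt0 invrK => /(_ r0) h.
have := Ar x; rewrite -ler_pdivrMl // => {}Ar; lra.
Qed.

Lemma is_adjointC A B : is_adjoint A B -> is_adjoint B A.
Proof. by move=> AB x y; rewrite innerC -AB -innerC. Qed.

End Operators.

(** * Closure properties of a von Neumann algebra *)

Section VonNeumannAlgebra.
Context {R : realType} {H : hilbertType R}.
Implicit Types (x y z : H) (A B C : H -> H).

Lemma bounded_comp A B : bounded_op A -> bounded_op B -> bounded_op (A \o B).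
Proof.
move=> bA bB; split=> [c x y /=|x]; first by rewrite (op_linear bB) (op_linear bA).
by apply: continuous_comp; [apply: bB.2|apply: bA.2].
Qed.

Lemma bounded_linC (c : R[i]) A B :
  bounded_op A -> bounded_op B -> bounded_op (c *: A + B).
Proof.
move=> bA bB; split=> [d x y|x].
  change (c *: A (d *: x + y) + B (d *: x + y) =
          d *: (c *: A x + B x) + (c *: A y + B y)).
  by rewrite (op_linear bA) (op_linear bB) !scalerDr !scalerA [c * d]mulrC addrACA.
change ((fun x => c *: A x + B x) @ x --> c *: A x + B x).
by apply: cvgD; [apply: cvgZ; [exact: cvg_cst|exact: bA.2]|exact: bB.2].
Qed.

Lemma bounded_id : bounded_op (id : H -> H).
Proof. by split=> [c x y //|x U]. Qed.

Context (M : set (H -> H)) (hM : von_neumann_algebra M).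

Lemma vna_bounded A : M A -> bounded_op A.
Proof. by rewrite -(vna_bicommutant hM) => -[]. Qed.

Lemma vnaP A : bounded_op A ->
  (forall B, commutant M B -> forall x, B (A x) = A (B x)) -> M A.
Proof.
move=> bA AB; rewrite -(vna_bicommutant hM); split=> // B MB.
by apply: funext => x /=; apply: AB.
Qed.

Lemma commutantE A B x : M A -> commutant M B -> B (A x) = A (B x).
Proof. by move=> MA [_ /(_ _ MA) /(congr1 (@^~ x))]. Qed.

Lemma vna_id : M id.
Proof. by apply: vnaP => //; exact: bounded_id. Qed.

Lemma vna_comp A B : M A -> M B -> M (A \o B).
Proof.
move=> MA MB; apply: vnaP; first by apply: bounded_comp; exact: vna_bounded.
by move=> C MC x /=; rewrite (commutantE _ MA MC) (commutantE _ MB MC).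
Qed.

Lemma vna_linC (c : R[i]) A B : M A -> M B -> M (c *: A + B).
Proof.
move=> MA MB; apply: vnaP; first by apply: bounded_linC; exact: vna_bounded.
move=> C MC x; change (C (c *: A x + B x) = c *: A (C x) + B (C x)).
by rewrite (op_linear MC.1) (commutantE _ MA MC) (commutantE _ MB MC).
Qed.

Lemma vnaB A B : M A -> M B -> M (A - B).
Proof. by move=> MA MB; rewrite addrC -scaleN1r; apply: vna_linC. Qed.

Lemma vnaD A B : M A -> M B -> M (A + B).
Proof. by move=> MA MB; rewrite -[A]scale1r; apply: vna_linC. Qed.

(** Commuting with a bounded operator passes to pointwise limits, so a
    bicommutant is closed under strong limits of sequences. *)
Lemma vna_lim (u : nat -> H -> H) A : bounded_op A -> (forall n, M (u n)) ->
  (forall x, u n x @[n --> \oo] --> A x) -> M A.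
Proof.
move=> bA Mu uA; apply: vnaP => // B MB x.
apply: lim_unique (uA (B x)).
apply: cvg_trans (op_cvg MB.1 (uA x)); apply: near_eq_cvg.
by apply: nearW => n /=; rewrite (commutantE _ (Mu n) MB).
Qed.

Lemma vna_adjoint A : M A -> exists2 B, M B & is_adjoint A B.
Proof.
move=> MA; have [B AB] := adjoint_exists (vna_bounded MA).
by exists B => //; exact: vna_star hM _ _ MA AB.
Qed.

End VonNeumannAlgebra.

(** * Powers of the defect operator *)

Section Defect.
Context {R : realType} {H : hilbertType R}.
Implicit Types (x y z : H) (A B : H -> H).

Definition contractive A := forall x, rip (A x) (A x) <= rip x x.

(** For [B] adjoint to a contraction [A], the square of the defect operator
    of [A]. *)
Definition defect A B : H -> H := id - (B \o A).

Lemma defectE A B x : defect A B x = x - B (A x).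
Proof. by []. Qed.

Lemma adjoint_rip A B x y : is_adjoint A B -> rip (A x) y = rip x (B y).
Proof. by rewrite /rip => ->. Qed.

(** From [|B x|^2 = <A B x, x>] and Young's inequality. *)
Lemma adjoint_contractive A B :
  is_adjoint A B -> contractive A -> contractive B.
Proof.
move=> AB cA x; have := rip_young (A (B x)) x (s := 1).
rewrite (adjoint_rip _ _ AB) ltr01 invr1 !mul1r => /(_ isT) h.
have := cA (B x); lra.
Qed.

Context (A B : H -> H) (bA : bounded_op A) (AB : is_adjoint A B)
  (cA : contractive A).
Let bB := adjoint_bounded bA AB.
Local Notation K := (defect A B).

Lemma defect_bounded : bounded_op K.
Proof.
rewrite /defect addrC -scaleN1r; apply: bounded_linC; last exact: bounded_id.
exact: bounded_comp.
Qed.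

Lemma defect_iter_adjoint n : is_adjoint (iter n K) (iter n K).
Proof.
elim: n => [//|n IH x y]; rewrite iterS iterSr -IH !defectE.
by rewrite innerBl innerBr (is_adjointC AB) AB.
Qed.

Lemma defect_iter_intertwine n x :
  A (iter n K x) = iter n (defect B A) (A x).
Proof. by elim: n => //= n <-; rewrite !defectE (opB bA). Qed.

Lemma rip_defect_iter n m x :
  rip (iter n K x) (iter m K x) = rip (iter (n + m) K x) x.
Proof. by rewrite addnC iterD (adjoint_rip _ _ (defect_iter_adjoint m)). Qed.

End Defect.

Section DefectPowers.
Context {R : realType} {H : hilbertType R}.
Implicit Types (x y z : H).
Context (A B : H -> H) (bA : bounded_op A) (AB : is_adjoint A B)
  (cA : contractive A).
Let BA := is_adjointC AB.
Local Notation K := (defect A B).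

Lemma rip_defect x : rip (K x) x = rip x x - rip (A x) (A x).
Proof. by rewrite defectE ripBl (adjoint_rip _ _ BA). Qed.

(** An even power is a square, and an odd one is [K^m K K^m] with [K >= 0]. *)
Lemma defect_iter_ge0 n x : 0 <= rip (iter n K x) x.
Proof.
rewrite -(odd_double_half n) -addnn addnA -rip_defect_iter //.
case: (odd n); rewrite ?rip_ge0 // add1n iterS rip_defect subr_ge0.
exact: cA.
Qed.

End DefectPowers.

Section DefectLimit.
Context {R : realType} {H : hilbertType R}.
Implicit Types (x y z : H).
Context (A B : H -> H) (bA : bounded_op A) (AB : is_adjoint A B)
  (cA : contractive A).
Let bB := adjoint_bounded bA AB.
Let BA := is_adjointC AB.
Let cB := adjoint_contractive AB cA.
Local Notation K := (defect A B).

(** [K^n - K^n.+1 = K^n B A = B K'^n A] with [K' = 1 - A B], and [K'^n >= 0]. *)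
Lemma defect_iter_decr n x : rip (iter n.+1 K x) x <= rip (iter n K x) x.
Proof.
rewrite iterSr defectE -subr_ge0 -ripBl -opB; last first.
  elim: n => [|n IH]; first exact: bounded_id.
  exact: bounded_comp (defect_bounded bA AB) IH.
rewrite opprB addrC subrK.
rewrite (adjoint_rip _ _ (defect_iter_adjoint AB n)) (adjoint_rip _ _ BA).
by rewrite defect_iter_intertwine // ripC defect_iter_ge0.
Qed.

(** With [a n = <K^n x, x>] one has
    [|K^n x - K^m x|^2 = a (n + n) - 2 a (n + m) + a (m + m)], which is small
    because [a] is decreasing and bounded below. *)
Lemma defect_iter_cvg x : exists y : H, iter n K x @[n --> \oo] --> y.
Proof.
pose a n := rip (iter n K x) x.
have ca : cvg (a @ \oo).
  apply: nonincreasing_is_cvgn.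
    by apply/nonincreasing_seqP => n; exact: defect_iter_decr.
  by exists 0 => _ [n _ <-]; exact: defect_iter_ge0.
have al n : lim (a @ \oo) <= a n.
  apply: nonincreasing_cvgn_ge => //; apply/nonincreasing_seqP => k.
  exact: defect_iter_decr.
apply: cauchy_rip_cvg => e e0.
have e2 : 0 < e / 2 by rewrite divr_gt0.
have /cvgrPdist_lt/(_ _ e2)[N _ hN] := ca.
exists N => n m Nn Nm; rewrite ripBl !ripBr !rip_defect_iter // [(m + n)%N]addnC.
have Na k : (N <= k)%N -> a k < lim (a @ \oo) + e / 2.
  by move=> /hN; rewrite /= ltr_distlC => /andP[_].
have := al (n + m)%N; have := Na (n + n)%N (leq_trans Nn (leq_addr _ _)).
have := Na (m + m)%N (leq_trans Nm (leq_addr _ _)); rewrite /a; lra.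
Qed.

(** The powers of [1 - B A] converge strongly to the projection onto the kernel
    of [A]: the limit is fixed by [1 - B A], hence killed by [B A] and by [A]. *)
Lemma defect_iter_lim : exists N : H -> H,
  [/\ is_proj N, forall x, A (N x) = 0, forall x, A x = 0 -> N x = x,
    forall x, iter n K x @[n --> \oo] --> N x &
    forall n x, rip (N x) x <= rip (iter n K x) x].
Proof.
have [N KN] := choice defect_iter_cvg.
have bK : bounded_op K := defect_bounded bA AB.
have bKn n : bounded_op (iter n K).
  elim: n => [|n IH]; first exact: bounded_id.
  exact: (bounded_comp bK IH).
have AN x : A (N x) = 0.
  have KNx : K (N x) = N x.
    apply: lim_unique (op_cvg bK (KN x)) _.
    by have := KN x; rewrite -(cvg_shiftS (fun n => iter n K x)).
  apply: rip_eq0; rewrite (adjoint_rip _ _ AB).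
  have -> : B (A (N x)) = 0 by rewrite -[LHS](subKr (N x)) -(defectE A B) KNx subrr.
  by rewrite ripC /rip inner0l.
have NA x : A x = 0 -> N x = x.
  move=> Ax; have Kx n : iter n K x = x.
    by elim: n => //= n ->; rewrite defectE Ax (op0 bB) subr0.
  apply: lim_unique (KN x) _.
  by under eq_fun do rewrite Kx; exact: cvg_cst.
have lN : linear N.
  move=> c x y.
  apply: lim_unique (KN _) _; under eq_fun do rewrite (op_linear (bKn _)).
  by apply: cvgD => //; apply: cvgZ => //; exact: cvg_cst.
have rN x y : rip (N x) y = rip x (N y).
  apply: (cvg_unique _ (cvg_rip (y := y) (KN x))) => //.
  have KC n : rip (iter n K x) y = rip (iter n K y) x.
    by rewrite (adjoint_rip _ _ (defect_iter_adjoint AB n)) ripC.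
  rewrite /= [rip x _]ripC; under eq_fun do rewrite KC.
  exact: cvg_rip.
have NN x : N (N x) = N x by exact: NA.
have bN : bounded_op N.
  apply: (@bound_op _ _ _ 1) => // x; rewrite mul1r.
  have := rip_young (N x) x (s := 1); rewrite ltr01 invr1 !mul1r => /(_ isT).
  have -> : rip (N x) (N x) = rip (N x) x by rewrite rN NN ripC.
  lra.
exists N; split=> //.
- split=> //; first by apply: funext => x; exact: NN.
  by move=> x y; apply: inner_rip_inj => c; rewrite -rN (opZ bN).
- move=> n x; have cN := cvg_rip (y := x) (KN x).
  rewrite -(cvg_lim (@Rhausdorff R) cN); apply: limr_le.
    by apply/cvg_ex; eexists; exact: cN.
  exists n => // m /= nm; rewrite -(subnK nm).
  elim: (m - n)%N => // k; apply: le_trans; exact: defect_iter_decr.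
Qed.

End DefectLimit.

(** * Projections and positivity *)

Section Projections.
Context {R : realType} {H : hilbertType R}.
Implicit Types (x y z : H) (A B C P Q : H -> H).

Lemma projK P : is_proj P -> forall x, P (P x) = P x.
Proof. by move=> [_ PP _] x; rewrite -[in RHS]PP. Qed.

Lemma proj_bounded P : is_proj P -> bounded_op P.
Proof. by case. Qed.

Lemma proj_rangeE P x : is_proj P -> range P x <-> P x = x.
Proof.
move=> pP; split=> [[y _ <-]|<-]; [exact: projK|by exists x].
Qed.

(** Taking adjoints turns [Q P = P] into [P Q = P]. *)
Lemma proj_absorb P Q : is_proj P -> is_proj Q ->
  (forall x, Q (P x) = P x) -> forall x, P (Q x) = P x.
Proof.
move=> [_ _ pP] [_ _ pQ] QP x; apply: inner_inj => z.
by rewrite pP pQ QP -pP.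
Qed.

Lemma proj_range_inj P Q : is_proj P -> is_proj Q -> range P = range Q -> P = Q.
Proof.
move=> pP pQ PQ; apply: funext => x.
have QP y : Q (P y) = P y by apply/proj_rangeE => //; rewrite -PQ; exists y.
have PQ' y : P (Q y) = Q y by apply/proj_rangeE => //; rewrite PQ; exists y.
by rewrite -(proj_absorb pP pQ QP).
Qed.

Lemma proj_onto_unique P (D : set H) : is_proj P -> range P = D -> proj_onto D = P.
Proof.
move=> pP PD; apply: xget_unique => [//|Q [pQ QD]].
by apply: proj_range_inj => //; rewrite QD PD.
Qed.

Lemma is_adjointB A B A' B' : is_adjoint A A' -> is_adjoint B B' ->
  is_adjoint (A - B) (A' - B').
Proof.
by move=> AA BB x y; rewrite !fctE innerBl innerBr AA BB.
Qed.

Lemma bounded_sub A B : bounded_op A -> bounded_op B -> bounded_op (A - B).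
Proof. by move=> bA bB; rewrite addrC -scaleN1r; exact: bounded_linC. Qed.

Lemma proj_compl P : is_proj P -> is_proj (id - P).
Proof.
move=> pP; have [bP _ aP] := pP; split.
- by apply: bounded_sub; [exact: bounded_id|].
- apply: funext => x /=; rewrite !fctE /= (opB bP) projK // subrr subr0 //.
- exact: is_adjointB.
Qed.

Lemma rip_proj P x : is_proj P -> rip (P x) x = rip (P x) (P x).
Proof.
by move=> pP; have [_ _ aP] := pP; rewrite -{1}(projK pP) (adjoint_rip _ _ aP).
Qed.

Lemma selfadjoint_inner A x :
  is_adjoint A A -> inner (A x) x = (rip (A x) x)%:C.
Proof.
move=> aA; have := innerC (A x) x; rewrite -aA /rip.
case: (inner _ _) => a b [] /= /eqP; rewrite -subr_eq0 opprK -mulr2n.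
by rewrite mulrn_eq0 /= => /eqP ->.
Qed.

Lemma positive_inner A x : op_le 0 A -> inner (A x) x = (rip (A x) x)%:C.
Proof.
move=> /(_ x); rewrite inner0l /rip => /ger0_Im; case: (inner _ _) => a b /= ->.
by [].
Qed.

Lemma op_le_rip A B : (forall x, inner (A x) x = (rip (A x) x)%:C) ->
  (forall x, inner (B x) x = (rip (B x) x)%:C) ->
  (forall x, rip (A x) x <= rip (B x) x) -> op_le A B.
Proof. by move=> hA hB h x; rewrite hA hB lecR. Qed.

Lemma op_le0_rip A : is_adjoint A A -> (forall x, 0 <= rip (A x) x) ->
  op_le 0 A.
Proof. by move=> aA A0 x; rewrite inner0l selfadjoint_inner // ler0c. Qed.

Lemma proj_op_ge0 P : is_proj P -> op_le 0 P.
Proof.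
move=> pP; have [_ _ aP] := pP.
by apply: op_le0_rip => // x; rewrite rip_proj // rip_ge0.
Qed.

End Projections.

(** * The trace of the two supports of an operator *)

Section TraceDefect.
Context {R : realType} {H : hilbertType R}.
Implicit Types (x y z : H).
Context (M : set (H -> H)) (hM : von_neumann_algebra M)
  (tau : (H -> H) -> R[i]) (htau : faithful_normal_trace M tau).

Lemma traceD A B : M A -> M B -> tau (A + B) = tau A + tau B.
Proof.
by move=> MA MB; rewrite -[A]scale1r (trace_linear htau) // scale1r mul1r.
Qed.

Lemma traceB A B : M A -> M B -> tau (A - B) = tau A - tau B.
Proof.
by move=> MA MB; rewrite addrC -scaleN1r (trace_linear htau) // mulN1r addrC.
Qed.

Context (A B : H -> H) (MA : M A) (MB : M B) (AB : is_adjoint A B)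
  (cA : contractive A).
Let bA := vna_bounded hM MA.
Let bB := vna_bounded hM MB.
Local Notation K := (defect A B).

Lemma vna_defect_iter n : M (iter n K).
Proof.
elim: n => [|n IH]; first exact: vna_id.
apply: (vna_comp hM _ IH); apply: (vnaB hM); first exact: vna_id.
exact: vna_comp.
Qed.

(** Normality applies to the increasing sequence [1 - K^n], whose least upper
    bound among the positive elements is [1 - N]. *)
Lemma defect_lub N : is_proj N ->
  (forall x, iter n K x @[n --> \oo] --> N x) ->
  (forall n x, rip (N x) x <= rip (iter n K x) x) ->
  M N /\
  supremums (tau @` range (fun n => (id - iter n K : H -> H))) (tau (id - N)).
Proof.
move=> pN KN NK; have bN := proj_bounded pN.
have MN : M N by exact: (vna_lim hM bN vna_defect_iter KN).
have MI : M id := vna_id hM.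
have aI : is_adjoint (id : H -> H) id by [].
have aK n : is_adjoint (id - iter n K) (id - iter n K).
  exact: is_adjointB aI (defect_iter_adjoint AB n).
have aN : is_adjoint (id - N) (id - N) by case: (proj_compl pN).
have pK n : positive_part M (id - iter n K).
  split; first exact: (vnaB hM MI (vna_defect_iter n)).
  apply: op_le0_rip => // x; rewrite !fctE ripBl subr_ge0.
  elim: n => // n; apply: le_trans; exact: (defect_iter_decr bA AB cA).
split=> //; apply: (trace_normal htau).
- by move=> _ [n _ <-].
- split; first by exists (id - iter 0 K), 0%N.
  have mono n m : (n <= m)%N -> op_le (id - iter n K) (id - iter m K).
    move=> nm; apply: op_le_rip => x; try exact: selfadjoint_inner.
    rewrite !fctE !ripBl lerD2l lerN2 -(subnK nm).
    elim: (m - n)%N => // k; apply: le_trans.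
    exact: (defect_iter_decr bA AB cA).
  move=> _ _ [n _ <-] [m _ <-]; exists (id - iter (maxn n m) K).
  split; first by exists (maxn n m).
    by apply: mono; rewrite leq_maxl.
  by apply: mono; rewrite leq_maxr.
- split.
  + split; first exact: (vnaB hM).
    exact/proj_op_ge0/proj_compl.
  + move=> _ [n _ <-]; apply: op_le_rip => x; try exact: selfadjoint_inner.
    by rewrite !fctE !ripBl lerD2l lerN2.
  + move=> C [MC C0] CK; apply: op_le_rip => x.
    * exact: selfadjoint_inner.
    * exact: positive_inner.
    have cN := cvg_rip (y := x) (KN x).
    rewrite !fctE ripBl lerBlDr -lerBlDl -(cvg_lim (@Rhausdorff R) cN).
    apply: limr_ge; first by apply/cvg_ex; eexists; exact: cN.
    apply: nearW => n; have := CK _ (ex_intro2 _ _ n I erefl) x.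
    rewrite (selfadjoint_inner _ (aK n)) (positive_inner _ C0) lecR.
    by rewrite !fctE ripBl; lra.
Qed.

End TraceDefect.

Section Supports.
Context {R : realType} {H : hilbertType R}.
Implicit Types (x y z : H).
Context (M : set (H -> H)) (hM : von_neumann_algebra M)
  (tau : (H -> H) -> R[i]) (htau : faithful_normal_trace M tau).
Implicit Types (A B C P Q : H -> H).

(** [1 - K^n = \sum_(k < n) B K'^k A] where [K = 1 - B A] and [K' = 1 - A B];
    a trace moves the left factor [B] to the right. *)
Lemma trace_defect_iter A B n : M A -> M B -> is_adjoint A B ->
  tau (id - iter n (defect A B)) = tau (id - iter n (defect B A)).
Proof.
move=> MA MB AB; elim: n => [//|n IH].
have bA := vna_bounded hM MA; have bB := vna_bounded hM MB.
have MI : M id := vna_id hM.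
have MK k : M (iter k (defect A B)) by exact: vna_defect_iter.
have MK' k : M (iter k (defect B A)) by exact: vna_defect_iter.
have MAK' : M (iter n (defect B A) \o A) by exact: vna_comp.
have stepK : (id - iter n.+1 (defect A B) : H -> H) =
    (B \o (iter n (defect B A) \o A)) + (id - iter n (defect A B)).
  apply: funext => x; rewrite !fctE /= -(defect_iter_intertwine B bA).
  by rewrite defectE opprB addrCA.
have stepK' : (id - iter n.+1 (defect B A) : H -> H) =
    ((iter n (defect B A) \o A) \o B) + (id - iter n (defect B A)).
  apply: funext => x; rewrite !fctE /= -(defect_iter_intertwine B bA).
  by rewrite -(defect_iter_intertwine A bB) defectE opprB addrCA.
have MB1 := vna_comp hM MB MAK'; have MB2 := vna_comp hM MAK' MB.
have MI1 := vnaB hM MI (MK n); have MI2 := vnaB hM MI (MK' n).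
rewrite stepK stepK' (traceD htau MB1 MI1) (traceD htau MB2 MI2) IH.
by rewrite (trace_comm htau MB MAK').
Qed.

(** With [K = 1 - B A] and [K' = 1 - A B], [N] and [N'] are the limits of [K^n] and
    [K'^n].  The range of [1 - N'] is the
    closure of that of [A] because [x - K'^n x] is an explicit value of [A]: it
    telescopes to [A] of a sum of vectors [B K'^k x]. *)
Lemma contractive_supports A B : M A -> M B -> is_adjoint A B ->
  contractive A -> exists N N' : H -> H,
  [/\ (M N /\ is_proj N) /\ (M N' /\ is_proj N'),
      (forall x, A (N x) = 0) /\ (forall x, A x = 0 -> N x = x),
      forall x, N' (A x) = 0,
      forall x, exists u : nat -> H, A \o u @ \oo --> x - N' x &
      tau (id - N) = tau (id - N')].
Proof.
move=> MA MB AB cA; have BA := is_adjointC AB.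
have cB := adjoint_contractive AB cA.
have bA := vna_bounded hM MA; have bB := vna_bounded hM MB.
have [N [pN AN NA KN NK]] := defect_iter_lim bA AB cA.
have [N' [pN' BN' NB' KN' NK']] := defect_iter_lim bB BA cB.
have [MN sN] := defect_lub hM htau MA MB AB cA pN KN NK.
have [MN' sN'] := defect_lub hM htau MB MA BA cB pN' KN' NK'.
exists N, N'; split=> //.
- move=> x; apply: inner_inj => z; have [_ _ aN'] := pN'.
  by rewrite aN' AB BN' inner0r inner0l.
- move=> x.
  pose u := fix u n := if n is k.+1 then B (iter k (defect B A) x) + u k else 0.
  have Au n : A (u n) = x - iter n (defect B A) x.
    elim: n => [|n IH] /=; first by rewrite (op0 bA) subrr.
    by rewrite (opD bA) IH defectE opprB addrCA.
  exists u; have -> : A \o u = fun n => x - iter n (defect B A) x by exact: funext.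
  by apply: cvgB; [exact: cvg_cst|exact: KN'].
- apply: (is_subset1_supremums sN); rewrite (_ : tau @` _ = tau @` range
    (fun n => (id - iter n (defect B A) : H -> H))) //.
  rewrite !image_comp; congr image; apply: funext => n /=.
  exact: trace_defect_iter.
Qed.

Lemma scale_contractive A : bounded_op A ->
  exists2 t : R, 0 < t & contractive (fun x => t%:C *: A x).
Proof.
move=> bA; have [r r0 Ar] := op_bound bA; have r1 : 0 < r + 1 by rewrite addr_gt0.
exists (r + 1)^-1; first by rewrite invr_gt0.
move=> x; rewrite ripZl ripZr mulrA -invfM mulrC ler_pdivrMr ?mulr_gt0 //.
apply: le_trans (Ar x) _; rewrite mulrC ler_wpM2l ?rip_ge0 //; nra.
Qed.

(** A positive multiple of [A] is contractive and has the same kernel and the same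
    range. *)
Lemma supports A : M A -> exists N N' : H -> H,
  [/\ (M N /\ is_proj N) /\ (M N' /\ is_proj N'),
      (forall x, A (N x) = 0) /\ (forall x, A x = 0 -> N x = x),
      forall x, N' (A x) = 0,
      forall x, exists u : nat -> H, A \o u @ \oo --> x - N' x &
      tau (id - N) = tau (id - N')].
Proof.
move=> MA; have bA := vna_bounded hM MA.
have [B MB AB] := vna_adjoint hM MA.
have [t t0 ct] := scale_contractive bA.
have tC0 : t%:C != 0 :> R[i] by rewrite gt_eqF // ltcR.
have MZ C : M C -> M (fun x => t%:C *: C x).
  move=> MC; have -> : (fun x => t%:C *: C x) = t%:C *: C + (id - id).
    by apply: funext => x; rewrite !fctE subrr addr0.
  by apply: vna_linC => //; apply: vnaB => //; exact: vna_id.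
have ZZ : is_adjoint (fun x => t%:C *: A x) (fun x => t%:C *: B x).
  by move=> x y; rewrite innerZl innerZr AB [Num.conj _]conjc_real.
have [N [N' [pN [AN NA] N'A uA tN]]] :=
  contractive_supports (MZ _ MA) (MZ _ MB) ZZ ct.
exists N, N'; split=> //.
- split=> x; first by have /eqP := AN x; rewrite scaler_eq0 (negbTE tC0) => /eqP.
  by move=> Ax; apply: NA; rewrite Ax scaler0.
- move=> x; have := N'A (t%:C^-1 *: x).
  by rewrite (opZ bA) scalerA divff // scale1r.
- move=> x; have [u Au] := uA x; exists (fun n => t%:C *: u n).
  by have -> : A \o (fun n => t%:C *: u n) = (fun x => t%:C *: A x) \o u
    by apply: funext => n /=; rewrite (opZ bA).
Qed.

End Supports.

(** * Kernel and range projections *)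

Section SupportProjections.
Context {R : realType} {H : hilbertType R}.
Implicit Types (x y z : H) (D : set H) (A B C P Q : H -> H).

Definition ker_proj A : H -> H := proj_onto (kernel A).
Definition ran_proj A : H -> H := proj_onto (closure (range A)).

Lemma closure_kernel C D x : bounded_op C -> (forall y, D y -> C y = 0) ->
  closure D x -> C x = 0.
Proof.
move=> [_ cC] CD; suff kC : closed (kernel C).
  by rewrite -[C x = 0]/(kernel C x) (iffLR (closure_id _) kC);
     apply: closure_subset.
apply: (@closed_comp _ _ C [set 0]) => [y _|]; first exact: cC.
exact/accessible_closed_set1/hausdorff_accessible/norm_hausdorff.
Qed.

Lemma proj_onto_closure P D : is_proj P -> D `<=` range P ->
  (forall x, closure D (P x)) -> proj_onto (closure D) = P.
Proof.
move=> pP DP PD; apply: proj_onto_unique => //; apply/seteqP; split=> x.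
  by move=> [y _ <-].
move=> Dx; apply/(proj_rangeE _ pP)/esym/eqP; rewrite -subr_eq0; apply/eqP.
apply: (closure_kernel (proj_bounded (proj_compl pP)) _ Dx) => y.
by move=> /DP /(proj_rangeE _ pP) Py; rewrite !fctE Py subrr.
Qed.

Lemma proj_fix_inj P Q : is_proj P -> is_proj Q ->
  (forall x, P x = x <-> Q x = x) -> P = Q.
Proof.
move=> pP pQ PQ; apply: proj_range_inj => //; apply/seteqP; split=> x.
  by move=> /(proj_rangeE _ pP) /PQ /(proj_rangeE _ pQ).
by move=> /(proj_rangeE _ pQ) /PQ /(proj_rangeE _ pP).
Qed.

End SupportProjections.

(** * Meets and joins of projections *)

Section ProjectionLattice.
Context {R : realType} {H : hilbertType R}.
Implicit Types (x y z : H).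
Context (M : set (H -> H)) (hM : von_neumann_algebra M)
  (tau : (H -> H) -> R[i]) (htau : faithful_normal_trace M tau).
Implicit Types (A B C P Q : H -> H).

Lemma ker_ran_proj A : M A ->
  [/\ projections M (ker_proj A) /\ projections M (ran_proj A),
      (forall x, A (ker_proj A x) = 0) /\ (forall x, A x = 0 -> ker_proj A x = x),
      forall x, ran_proj A (A x) = A x,
      forall x, closure (range A) (ran_proj A x) &
      tau (id - ker_proj A) = tau (ran_proj A)].
Proof.
move=> MA; have [N [N' [[[MN pN] [MN' pN']] [AN NA] N'A uA tN]]] :=
  supports hM htau MA.
have kN : ker_proj A = N.
  apply: proj_onto_unique => //; apply/seteqP; split=> x.
    by move=> [y _ <-]; exact: AN.
  by move=> Ax; exists x => //; exact: NA.
have pE := proj_compl pN'.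
have cE x : closure (range A) (x - N' x).
  have [u Au] := uA x.
  apply: (@closed_cvg _ _ _ _ (A \o u) (closure (range A))) Au.
    exact: closed_closure.
  by apply: nearW => n; apply: subset_closure; exists (u n).
have rN : ran_proj A = id - N'.
  apply: proj_onto_closure => //.
  by move=> _ [x _ <-]; apply/(proj_rangeE _ pE); rewrite !fctE N'A subr0.
have ME : M (id - N') by apply: vnaB => //; exact: vna_id.
rewrite kN rN; split=> // x.
by rewrite !fctE N'A subr0.
Qed.

Lemma ker_projP A : M A -> projections M (ker_proj A).
Proof. by case/ker_ran_proj=> -[]. Qed.

Lemma ker_projE A x : M A -> ker_proj A x = x <-> A x = 0.
Proof.
by move=> /ker_ran_proj[_ [AN NA] _ _ _]; split=> [<-|]; [exact: AN|exact: NA].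
Qed.

Lemma ran_projP A : M A -> projections M (ran_proj A).
Proof. by case/ker_ran_proj=> -[]. Qed.

Lemma ran_proj_id A x : M A -> ran_proj A (A x) = A x.
Proof. by case/ker_ran_proj. Qed.

Lemma ran_proj_closure A x : M A -> closure (range A) (ran_proj A x).
Proof. by case/ker_ran_proj. Qed.

(** Minimality of the range projection.  With [C = 1 - E] it says that a projection
    [E] whose range contains that of [A] dominates [ran_proj A]; other choices of
    [C] give invariance statements. *)
Lemma ran_proj_eq0 A C x : M A -> bounded_op C -> (forall y, C (A y) = 0) ->
  C (ran_proj A x) = 0.
Proof.
move=> MA bC CA; apply: (closure_kernel bC _ (ran_proj_closure MA)) => _ [y _ <-].
exact: CA.
Qed.

Lemma trace_supports A : M A -> tau (id - ker_proj A) = tau (ran_proj A).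
Proof. by case/ker_ran_proj. Qed.

(** A sum of two positive operators kills a vector only if both do. *)
Lemma compl_sum_eq0 P Q x : is_proj P -> is_proj Q ->
  ((id - P) + (id - Q)) x = 0 <-> P x = x /\ Q x = x.
Proof.
move=> pP pQ; rewrite !fctE; split=> [PQ0|[-> ->]]; last first.
  by rewrite subrr addr0.
have : rip (x - P x) x + rip (x - Q x) x = 0 by rewrite -ripDl PQ0 /rip inner0l.
have := rip_proj x (proj_compl pP); have := rip_proj x (proj_compl pQ).
rewrite !fctE => -> ->.
have := rip_ge0 (x - P x); have := rip_ge0 (x - Q x) => Q0 P0 PQ.
have /rip_eq0/eqP : rip (x - P x) (x - P x) = 0 by lra.
have /rip_eq0/eqP : rip (x - Q x) (x - Q x) = 0 by lra.
by rewrite !subr_eq0 => /eqP Qx /eqP Px.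
Qed.

Lemma pmeetE P Q : is_proj P -> is_proj Q ->
  pmeet P Q = ker_proj ((id - P) + (id - Q)).
Proof.
move=> pP pQ; rewrite /pmeet /ker_proj; congr proj_onto.
apply/seteqP; split=> x.
  move=> [/(proj_rangeE _ pP) Px /(proj_rangeE _ pQ) Qx].
  exact/compl_sum_eq0.
move=> /(compl_sum_eq0 _ pP pQ)[Px Qx].
by split; [apply/(proj_rangeE _ pP)|apply/(proj_rangeE _ pQ)].
Qed.

Lemma vna_compl_sum P Q : M P -> M Q -> M ((id - P) + (id - Q)).
Proof.
by move=> MP MQ; apply: vnaD => //; apply: vnaB => //; exact: vna_id.
Qed.

Lemma pmeet_proj P Q : projections M P -> projections M Q ->
  projections M (pmeet P Q).
Proof.
move=> [MP pP] [MQ pQ]; rewrite pmeetE //; apply: ker_projP.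
exact: vna_compl_sum.
Qed.

Lemma pmeet_fix P Q x : projections M P -> projections M Q ->
  pmeet P Q x = x <-> P x = x /\ Q x = x.
Proof.
move=> [MP pP] [MQ pQ]; rewrite pmeetE // ker_projE; last exact: vna_compl_sum.
exact: compl_sum_eq0.
Qed.

Lemma proj_sum_eq0 P Q x : is_proj P -> is_proj Q ->
  (P + Q) x = 0 -> P x = 0 /\ Q x = 0.
Proof.
move=> pP pQ; rewrite !fctE => PQ0.
have : rip (P x) x + rip (Q x) x = 0 by rewrite -ripDl PQ0 /rip inner0l.
rewrite !rip_proj //.
have := rip_ge0 (P x); have := rip_ge0 (Q x) => Q0 P0 PQ.
by split; apply: rip_eq0; lra.
Qed.

(** A vector killed by [P + Q] is killed by [P]; taking adjoints, a projection
    that absorbs [P + Q] absorbs [P]. *)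
Lemma ran_proj_sumL P Q x : projections M P -> projections M Q ->
  ran_proj (P + Q) (P x) = P x.
Proof.
move=> [MP pP] [MQ pQ]; have MPQ := vnaD hM MP MQ.
have [ME pE] := ran_projP MPQ; have [bE _ aE] := pE.
have [[bP _ aP] [_ _ aQ]] := (pP, pQ).
have aPQ : is_adjoint (P + Q) (P + Q).
  by move=> u v; rewrite !fctE innerDl innerDr aP aQ.
have PQC z : (P + Q) (z - ran_proj (P + Q) z) = 0.
  apply: inner_inj => w; rewrite inner0l.
  by rewrite aPQ innerBl aE ran_proj_id // subrr.
apply: inner_inj => w; apply/esym/eqP; rewrite -subr_eq0 aE !aP -innerBr.
by rewrite -(opB bP) (proj_sum_eq0 pP pQ (PQC w)).1 inner0r.
Qed.

Lemma ran_proj_sumR P Q x : projections M P -> projections M Q ->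
  ran_proj (P + Q) (Q x) = Q x.
Proof. by move=> PM QM; rewrite addrC ran_proj_sumL. Qed.

Lemma pjoinE P Q : projections M P -> projections M Q ->
  pjoin P Q = ran_proj (P + Q).
Proof.
move=> PM QM; have [[MP pP] [MQ pQ]] := (PM, QM).
have MPQ := vnaD hM MP MQ; have [ME pE] := ran_projP MPQ.
apply: proj_onto_closure => //.
  move=> _ [_ [x _ <-] [_ [y _ <-] <-]]; apply/(proj_rangeE _ pE).
  by rewrite (opD (proj_bounded pE)) ran_proj_sumL // ran_proj_sumR.
move=> x; apply: closure_subset (ran_proj_closure MPQ) => _ [y _ <-].
by exists (P y); [exists y|exists (Q y); [exists y|]].
Qed.

Lemma pjoin_proj P Q : projections M P -> projections M Q ->
  projections M (pjoin P Q).
Proof.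
move=> PM QM; rewrite pjoinE //; apply: ran_projP.
by apply: vnaD => //; [case: PM|case: QM].
Qed.

Lemma pjoinl P Q x : projections M P -> projections M Q ->
  pjoin P Q (P x) = P x.
Proof. by move=> PM QM; rewrite pjoinE // ran_proj_sumL. Qed.

Lemma pjoinr P Q x : projections M P -> projections M Q ->
  pjoin P Q (Q x) = Q x.
Proof. by move=> PM QM; rewrite pjoinE // ran_proj_sumR. Qed.

(** Minimality of the join, in the form of [ran_proj_eq0]. *)
Lemma pjoin_eq0 P Q C x : projections M P -> projections M Q -> bounded_op C ->
  (forall y, C (P y) = 0) -> (forall y, C (Q y) = 0) -> C (pjoin P Q x) = 0.
Proof.
move=> PM QM bC CP CQ; rewrite pjoinE //; apply: ran_proj_eq0 => //.
  by apply: vnaD => //; [case: PM|case: QM].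
by move=> y; rewrite !fctE (opD bC) CP CQ addr0.
Qed.

End ProjectionLattice.

(** * Comparison of projections by their trace *)

Section Comparison.
Context {R : realType} {H : hilbertType R}.
Implicit Types (x y z : H).
Context (M : set (H -> H)) (hM : von_neumann_algebra M)
  (tau : (H -> H) -> R[i]) (htau : faithful_normal_trace M tau).
Implicit Types (A B C P Q : H -> H).

Definition proj_le P Q := forall x, Q (P x) = P x.

Lemma proj_le_anti P Q : is_proj P -> is_proj Q ->
  proj_le P Q -> proj_le Q P -> P = Q.
Proof.
by move=> pP pQ PQ QP; apply: funext => x; rewrite -(proj_absorb pP pQ PQ) QP.
Qed.

(** The difference is a projection of trace zero, so faithfulness applies. *)
Lemma proj_le_trace P Q : projections M P -> projections M Q ->
  proj_le P Q -> tau P = tau Q -> P = Q.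
Proof.
move=> [MP pP] [MQ pQ] PQ tPQ; have PQ' := proj_absorb pP pQ PQ.
have [[bP _ aP] [bQ _ aQ]] := (pP, pQ).
have pQP : is_proj (Q - P).
  split; [exact: bounded_sub| |exact: is_adjointB].
  apply: funext => x; rewrite /= !fctE (opB bP) (opB bQ) PQ PQ' !projK //.
  by rewrite subrr subr0.
have : Q - P = 0.
  apply: (trace_faithful htau); last by rewrite (traceB htau) // tPQ subrr.
  by split; [exact: vnaB|exact: proj_op_ge0].
by move=> /eqP; rewrite subr_eq0 => /eqP.
Qed.

Lemma pmeet_lel P Q : projections M P -> projections M Q -> proj_le (pmeet P Q) P.
Proof.
move=> PM QM x; have pm := pmeet_proj hM htau PM QM.
by have /(pmeet_fix hM htau _ PM QM)[] := projK pm.2 x.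
Qed.

Lemma pmeet_ler P Q : projections M P -> projections M Q -> proj_le (pmeet P Q) Q.
Proof.
move=> PM QM x; have pm := pmeet_proj hM htau PM QM.
by have /(pmeet_fix hM htau _ PM QM)[] := projK pm.2 x.
Qed.

Lemma pmeet_glb P Q E : projections M P -> projections M Q ->
  proj_le E P -> proj_le E Q -> proj_le E (pmeet P Q).
Proof. by move=> PM QM EP EQ x; apply/(pmeet_fix hM htau _ PM QM). Qed.

Lemma pjoin_lub P Q E : projections M P -> projections M Q -> is_proj E ->
  proj_le P E -> proj_le Q E -> proj_le (pjoin P Q) E.
Proof.
move=> PM QM pE PE QE x; apply/esym/eqP; rewrite -subr_eq0; apply/eqP.
apply: (@pjoin_eq0 _ _ _ hM _ htau P Q (id - E)) => // [|y|y].
- exact: proj_bounded (proj_compl pE).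
- by rewrite !fctE PE subrr.
- by rewrite !fctE QE subrr.
Qed.

(** Kaplansky's formula: [P - P /\ Q] and [P \/ Q - Q] are the two supports of
    [(1 - Q) P], hence have the same trace. *)
Lemma trace_modular P Q : projections M P -> projections M Q ->
  tau (pmeet P Q) + tau (pjoin P Q) = tau P + tau Q.
Proof.
move=> PM QM; have [[MP pP] [MQ pQ]] := (PM, QM).
have [[bP _ aP] [bQ _ aQ]] := (pP, pQ).
have mM := pmeet_proj hM htau PM QM; have jM := pjoin_proj hM htau PM QM.
have [[Mm pm] [Mj pj]] := (mM, jM).
have MI : M id := vna_id hM.
pose A := (id - Q) \o P.
have MA : M A by apply: (vna_comp hM) => //; exact: (vnaB hM).
have AE x : A x = P x - Q (P x) by [].
have [[MN pN] [ME pE]] := (ker_projP hM htau MA, ran_projP hM htau MA).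
(* The kernel of [A] is the orthogonal sum of the ranges of [1 - P] and
   [P /\ Q], so its projection agrees with [P /\ Q] on the range of [P]. *)
have kerN : id - ker_proj A = P - pmeet P Q.
  have kP x : ker_proj A (x - P x) = x - P x.
    apply/(ker_projE hM htau _ MA).
    by rewrite AE (opB bP) projK // subrr (op0 bQ) subrr.
  have bN := proj_bounded pN.
  have NP x : ker_proj A (P x) = ker_proj A x - (x - P x).
    by rewrite -[in RHS]kP -(opB bN) subKr.
  have PN x : P (ker_proj A (P x)) = ker_proj A (P x).
    have := proj_absorb (proj_compl pP) pN kP x.
    by rewrite !fctE NP (opB bP) (opB bP) projK // subrr subr0 => <-; rewrite subKr.
  have mN x : pmeet P Q (ker_proj A (P x)) = pmeet P Q x.
    have Nm y : ker_proj A (pmeet P Q y) = pmeet P Q y.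
      apply/(ker_projE hM htau _ MA).
      by rewrite AE pmeet_lel // pmeet_ler // subrr.
    rewrite (proj_absorb pm pN Nm) (proj_absorb pm pP) //.
    exact: pmeet_lel.
  have {}mN x : ker_proj A (P x) = pmeet P Q x.
    rewrite -mN; apply/esym/(pmeet_fix hM htau _ PM QM); split=> //.
    have /(ker_projE hM htau _ MA) := projK pN (P x).
    by rewrite AE PN => /eqP; rewrite subr_eq0 => /eqP <-.
  apply: funext => x; rewrite !fctE -mN NP.
  by rewrite opprB addrA [P x + _]addrC subrK.
(* [ran_proj A] is orthogonal to [Q], and [1 - Q - ran_proj A] kills both [P] and
   [Q], hence their join. *)
have ranE : ran_proj A = pjoin P Q - Q.
  have QE x : Q (ran_proj A x) = 0.
    apply: (ran_proj_eq0 hM htau _ MA bQ) => y.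
    by rewrite AE (opB bQ) projK // subrr.
  have EQ x : ran_proj A (Q x) = 0.
    have [_ _ aE] := pE.
    by apply: inner_inj => z; rewrite aE aQ QE inner0r inner0l.
  have jE x : pjoin P Q (ran_proj A x) = ran_proj A x.
    have bC := proj_bounded (proj_compl pj).
    apply/esym/eqP; rewrite -subr_eq0; apply/eqP.
    apply: (ran_proj_eq0 hM htau _ MA bC) => y.
    rewrite !fctE AE (opB (proj_bounded pj)).
    by rewrite (pjoinl hM htau) // (pjoinr hM htau) // subrr.
  have bE := proj_bounded pE.
  apply: funext => x; rewrite !fctE; apply/esym/eqP; rewrite subr_eq addrC.
  have Qj := proj_absorb pQ pj (fun y => pjoinr hM htau y PM QM) x.
  have Ej := proj_absorb pE pj jE x.
  rewrite -subr_eq0 -{1}Qj -Ej opprD addrA; apply/eqP.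
  have MC : M (id - Q - ran_proj A) by apply: (vnaB hM) => //; exact: (vnaB hM).
  apply: (@pjoin_eq0 _ _ _ hM _ htau P Q (id - Q - ran_proj A)) => //.
  - exact: (vna_bounded hM MC).
  - move=> y; have := ran_proj_id hM htau y MA.
    by rewrite AE (opB bE) EQ subr0 !fctE => ->; rewrite subrr.
  - by move=> y; rewrite !fctE projK // EQ subrr subr0.
have := trace_supports hM htau MA; rewrite kerN ranE !(traceB htau) //.
move=> /eqP; rewrite subr_eq addrAC eq_sym subr_eq => /eqP e.
by rewrite addrC.
Qed.

End Comparison.

(** * Trace-preserving maps between lattices of projections *)

Section TraceEmbedding.
Context {R : realType} {H : hilbertType R}.
Implicit Types (x y z : H).
Context (M : set (H -> H)) (hM : von_neumann_algebra M)
  (tau : (H -> H) -> R[i]) (htau : faithful_normal_trace M tau).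
Implicit Types (A B C P Q : H -> H).

Lemma pmeet_idl P Q : projections M P -> projections M Q -> proj_le P Q ->
  pmeet P Q = P.
Proof.
move=> PM QM PQ; have [_ pm] := pmeet_proj hM htau PM QM.
apply: proj_le_anti => //; [exact: PM.2|exact: (pmeet_lel hM htau)|].
by apply: (pmeet_glb hM htau) => // x; rewrite projK //; exact: PM.2.
Qed.

Lemma pjoin_idr P Q : projections M P -> projections M Q -> proj_le P Q ->
  pjoin P Q = Q.
Proof.
move=> PM QM PQ; have [_ pj] := pjoin_proj hM htau PM QM.
apply: proj_le_anti => //; [exact: QM.2| |by move=> x; exact: (pjoinr hM htau)].
apply: (pjoin_lub hM htau) => //; first exact: QM.2.
by move=> x; rewrite projK //; exact: QM.2.
Qed.

Context (L L' : set (H -> H)) (phi : (H -> H) -> (H -> H)).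
Hypotheses (sL : sublattice L (projections M)) (L'M : L' `<=` projections M)
  (phiL : forall P, L P -> L' (phi P))
  (tphi : forall P, L P -> tau (phi P) = tau P).

Let LM P : L P -> projections M P. Proof. exact: sL.1. Qed.
Let phiM P : L P -> projections M (phi P). Proof. by move=> /phiL /L'M. Qed.

(** [phi P \/ phi Q] lies below [phi (P \/ Q)], and Kaplansky's formula in source
    and target shows that they have the same trace. *)
Lemma trace_meet_join :
  (forall P Q, L P -> L Q -> phi (pmeet P Q) = pmeet (phi P) (phi Q)) ->
  forall P Q, L P -> L Q -> phi (pjoin P Q) = pjoin (phi P) (phi Q).
Proof.
move=> phiI P Q LP LQ; have [Lm Lj] := sL.2 _ _ LP LQ.
have mono A B : L A -> L B -> proj_le A B -> proj_le (phi A) (phi B).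
  move=> LA LB AB; rewrite -(pmeet_idl (LM LA) (LM LB) AB) phiI //.
  by apply: (pmeet_ler hM htau); exact: phiM.
apply/esym/(proj_le_trace hM htau).
- by apply: (pjoin_proj hM htau); exact: phiM.
- exact: phiM.
- apply: (pjoin_lub hM htau); try exact: phiM; first exact: (phiM Lj).2.
  + by apply: mono => // x; apply: (pjoinl hM htau); exact: LM.
  + by apply: mono => // x; apply: (pjoinr hM htau); exact: LM.
- have := trace_modular hM htau (phiM LP) (phiM LQ).
  rewrite !tphi // -phiI // tphi // -(trace_modular hM htau (LM LP) (LM LQ)).
  exact: addrI.
Qed.

Lemma trace_join_meet :
  (forall P Q, L P -> L Q -> phi (pjoin P Q) = pjoin (phi P) (phi Q)) ->
  forall P Q, L P -> L Q -> phi (pmeet P Q) = pmeet (phi P) (phi Q).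
Proof.
move=> phiU P Q LP LQ; have [Lm Lj] := sL.2 _ _ LP LQ.
have mono A B : L A -> L B -> proj_le A B -> proj_le (phi A) (phi B).
  move=> LA LB AB; rewrite -(pjoin_idr (LM LA) (LM LB) AB) phiU // => x.
  by apply: (pjoinl hM htau); exact: phiM.
apply: (proj_le_trace hM htau).
- exact: phiM.
- by apply: (pmeet_proj hM htau); exact: phiM.
- apply: (pmeet_glb hM htau); try exact: phiM.
  + by apply: mono => //; apply: (pmeet_lel hM htau); exact: LM.
  + by apply: mono => //; apply: (pmeet_ler hM htau); exact: LM.
- have := trace_modular hM htau (phiM LP) (phiM LQ).
  rewrite -phiU // !tphi // -(trace_modular hM htau (LM LP) (LM LQ)).
  by move/addIr.
Qed.

(** If [phi P = phi Q], then [phi (P /\ Q) = phi P], so that [P /\ Q] has the trace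
    of [P] and equals it; this gives injectivity. *)
Lemma trace_embedding :
  (forall P Q, L P -> L Q -> phi (pmeet P Q) = pmeet (phi P) (phi Q)) \/
  (forall P Q, L P -> L Q -> phi (pjoin P Q) = pjoin (phi P) (phi Q)) ->
  iso_to_sublattice L L'.
Proof.
move=> h.
have phiI : forall P Q, L P -> L Q -> phi (pmeet P Q) = pmeet (phi P) (phi Q).
  by case: h => // /trace_join_meet.
have phiU := trace_meet_join phiI.
have inj P Q : L P -> L Q -> phi P = phi Q -> proj_le P Q.
  move=> LP LQ PQ; have [Lm _] := sL.2 _ _ LP LQ.
  suff <- : pmeet P Q = P by apply: (pmeet_ler hM htau); exact: LM.
  apply: (proj_le_trace hM htau); try exact: LM.
    by apply: (pmeet_lel hM htau); exact: LM.
  rewrite -(tphi Lm) -(tphi LP) phiI // -PQ pmeet_idl //; try exact: phiM.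
  by move=> x; rewrite projK //; exact: (phiM LP).2.
exists (phi @` L), phi; split; split.
- by move=> _ [P LP <-]; exact: phiL.
- move=> _ _ [P LP <-] [Q LQ <-]; have [Lm Lj] := sL.2 _ _ LP LQ.
  by rewrite -phiI // -phiU //; split; apply: imageP.
- split=> //; move=> P Q /set_mem LP /set_mem LQ PQ.
  apply: proj_le_anti; [exact: (LM LP).2|exact: (LM LQ).2|exact: inj|].
  exact: inj.
- by move=> P Q LP LQ; split; [exact: phiI|exact: phiU].
Qed.

(** A projection with the trace of 0 or of the identity is 0 or the identity, so
    triviality is reflected even though [phi] is only an embedding. *)
Lemma trace_trivial : L 0 -> L id -> L' = [set (0 : H -> H); (id : H -> H)] ->
  L = [set (0 : H -> H); (id : H -> H)].
Proof.
move=> L0 L1 L'01; apply/seteqP; split=> [P LP|P [->|->]//].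
have [MP pP] := LM LP.
have := phiL LP; rewrite L'01 => -[P0|P1]; [left|right].
- apply/esym/(proj_le_trace hM htau); try exact: LM.
    by move=> x; exact: op0 (proj_bounded pP).
  by rewrite -(tphi LP) P0.
- by apply: (proj_le_trace hM htau); try exact: LM; rewrite // -(tphi LP) P1.
Qed.

End TraceEmbedding.

(** * Invariant subspaces along an injective intertwiner *)

Section InvariantSubspaces.
Context {R : realType} {H : hilbertType R}.
Implicit Types (x y z : H).
Context (M : set (H -> H)) (hM : von_neumann_algebra M)
  (tau : (H -> H) -> R[i]) (htau : faithful_normal_trace M tau).
Implicit Types (A B C P Q : H -> H).

Lemma LatP T P : Lat M T P <-> projections M P /\ forall x, P (T (P x)) = T (P x).
Proof.
split=> -[PM TP]; split=> //; first by move=> x; have /(congr1 (@^~ x)) := TP.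
by apply: funext => x; rewrite /= TP.
Qed.

Lemma Lat_sublattice T : M T -> sublattice (Lat M T) (projections M).
Proof.
move=> MT; have bT := vna_bounded hM MT; split=> [P []//|P Q].
move=> /LatP[PM TP] /LatP[QM TQ].
have mM := pmeet_proj hM htau PM QM; have jM := pjoin_proj hM htau PM QM.
split; apply/LatP; split=> // x.
  apply/(pmeet_fix hM htau _ PM QM).
  have mP := pmeet_lel hM htau PM QM x; have mQ := pmeet_ler hM htau PM QM x.
  by split; [rewrite -mP TP|rewrite -mQ TQ].
have bC : bounded_op ((id - pjoin P Q) \o T).
  by apply: bounded_comp => //; exact: proj_bounded (proj_compl jM.2).
apply/esym/eqP; rewrite -subr_eq0; apply/eqP.
apply: (pjoin_eq0 hM htau x PM QM bC) => y; rewrite /= !fctE.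
  by rewrite -TP (pjoinl hM htau) // subrr.
by rewrite -TQ (pjoinr hM htau) // subrr.
Qed.

Lemma Lat_0 T : M T -> Lat M T 0.
Proof.
move=> MT; have MI := vna_id hM; have bT := vna_bounded hM MT.
have E0 : (0 : H -> H) = id - id by rewrite subrr.
apply/LatP; split=> [|x]; last exact: esym (op0 bT).
by split; rewrite E0; [exact: vnaB|apply: proj_compl; split=> //; exact: bounded_id].
Qed.

Lemma Lat_id T : Lat M T id.
Proof.
apply/LatP; split=> //; split; first exact: vna_id.
by split=> //; exact: bounded_id.
Qed.

Context (S T X : H -> H) (MS : M S) (MT : M T) (MX : M X)
  (kX : kernel X = [set 0]) (XS : X \o S = T \o X).
Let XSx x : X (S x) = T (X x). Proof. by have /(congr1 (@^~ x)) := XS. Qed.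
Let X0 x : X x = 0 -> x = 0. Proof. by rewrite -[x = 0]/([set 0] x) -kX. Qed.
Let MI : M id := vna_id hM.
Let bX := vna_bounded hM MX.
Let bT := vna_bounded hM MT.

(** An injective operator has dense range: its range projection has the trace of
    the complement of its kernel projection, that is, of the identity. *)
Lemma injective_ran_proj : ran_proj X = id.
Proof.
have [RM pR] := ran_projP hM htau MX.
have [_ pI] : projections M id by case: (Lat_id T).
apply: (proj_le_trace hM htau) => //.
rewrite -(trace_supports hM htau MX); congr tau; apply: funext => x.
have [_ pK] := ker_projP hM htau MX.
rewrite !fctE; have -> : ker_proj X x = 0; last by rewrite subr0.
by apply: X0; apply/(ker_projE hM htau _ MX); exact: projK.
Qed.

Definition push_proj P := ran_proj (X \o P).
Definition pull_proj Q := ker_proj ((id - Q) \o X).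

Let MXP P : M P -> M (X \o P). Proof. by move=> MP; exact: vna_comp. Qed.
Let MQX Q : M Q -> M ((id - Q) \o X).
Proof. by move=> MQ; apply: vna_comp => //; exact: vnaB. Qed.

Lemma push_proj_id P x : M P -> push_proj P (X (P x)) = X (P x).
Proof. by move=> MP; rewrite /push_proj (ran_proj_id hM htau x (MXP MP)). Qed.

Lemma pull_proj_fix Q x : M Q -> pull_proj Q x = x <-> Q (X x) = X x.
Proof.
move=> MQ; rewrite (ker_projE hM htau _ (MQX MQ)) /= !fctE.
by split=> [/eqP|->]; rewrite ?subrr // subr_eq0 => /eqP.
Qed.

(** [T X P = X S P = X P S P], so [T] maps the range of [X P] into itself. *)
Lemma push_proj_Lat P : Lat M S P -> Lat M T (push_proj P).
Proof.
move=> /LatP[[MP pP] SP]; have [MR pR] := ran_projP hM htau (MXP MP).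
apply/LatP; split=> // x; apply/esym/eqP; rewrite -subr_eq0; apply/eqP.
have bC : bounded_op ((id - push_proj P) \o T).
  by apply: bounded_comp => //; exact: proj_bounded (proj_compl pR).
apply: (ran_proj_eq0 hM htau x (MXP MP) bC) => y.
by rewrite /= !fctE -XSx -SP push_proj_id // subrr.
Qed.

(** If [X x] lies in the range of [Q], so does [X S x = T X x]. *)
Lemma pull_proj_Lat Q : Lat M T Q -> Lat M S (pull_proj Q).
Proof.
move=> /LatP[[MQ pQ] TQ]; have [MK pK] := ker_projP hM htau (MQX MQ).
apply/LatP; split=> // x; apply/(pull_proj_fix _ MQ); rewrite XSx.
by have /(pull_proj_fix _ MQ) <- := projK pK x; rewrite TQ.
Qed.

(** [X P] has the kernel of [P] by injectivity of [X]. *)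
Lemma trace_push_proj P : projections M P -> tau (push_proj P) = tau P.
Proof.
move=> [MP pP]; rewrite /push_proj -(trace_supports hM htau (MXP MP)).
have [MK pK] := ker_projP hM htau (MXP MP).
congr tau; rewrite -[RHS](subKr id); congr (_ - _).
apply: proj_fix_inj => [//||x]; first exact: proj_compl.
rewrite (ker_projE hM htau _ (MXP MP)) /= !fctE.
split=> [/X0 ->|/eqP]; first by rewrite subr0.
by rewrite -subr_eq0 addrAC subrr sub0r oppr_eq0 => /eqP ->; rewrite (op0 bX).
Qed.

(** [(1 - Q) X] has range dense in that of [1 - Q], since [X] has dense range. *)
Lemma trace_pull_proj Q : projections M Q -> tau (pull_proj Q) = tau Q.
Proof.
move=> [MQ pQ]; have [MK pK] := ker_projP hM htau (MQX MQ).
have [ME pE] := ran_projP hM htau (MQX MQ).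
have [MQ' pQ'] : projections M (id - Q) by split; [exact: vnaB|exact: proj_compl].
have bQ' := proj_bounded pQ'.
have RE : ran_proj ((id - Q) \o X) = id - Q.
  apply: proj_le_anti => // x.
    have bC : bounded_op (id - (id - Q)).
      by apply: bounded_sub => //; exact: bounded_id.
    apply/esym/eqP; rewrite -subr_eq0; apply/eqP.
    apply: (ran_proj_eq0 hM htau x (MQX MQ) bC) => y.
    have -> : (id - (id - Q)) (((id - Q) \o X) y) = Q (X y - Q (X y)).
      by rewrite fctE; exact: subKr.
    by rewrite (opB (proj_bounded pQ)) projK // subrr.
  have bC : bounded_op ((id - ran_proj ((id - Q) \o X)) \o (id - Q)).
    by apply: bounded_comp => //; exact: proj_bounded (proj_compl pE).
  apply/esym/eqP; rewrite -subr_eq0; apply/eqP.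
  have := ran_proj_eq0 hM htau x MX bC; rewrite injective_ran_proj; apply => y.
  change ((id - Q) (X y) - ran_proj ((id - Q) \o X) ((id - Q) (X y)) = 0).
  apply/eqP; rewrite subr_eq0; apply/eqP.
  exact: esym (ran_proj_id hM htau y (MQX MQ)).
have := trace_supports hM htau (MQX MQ); rewrite RE !(traceB htau) //.
by move=> /addrI/oppr_inj.
Qed.

Lemma push_proj_join P Q : projections M P -> projections M Q ->
  push_proj (pjoin P Q) = pjoin (push_proj P) (push_proj Q).
Proof.
move=> PM QM; have [[MP pP] [MQ pQ]] := (PM, QM).
have [Mj pj] := pjoin_proj hM htau PM QM.
have PM' := ran_projP hM htau (MXP MP); have QM' := ran_projP hM htau (MXP MQ).
have [MJ pJ] := ran_projP hM htau (MXP Mj).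
have [MJ' pJ'] := pjoin_proj hM htau PM' QM'.
apply: proj_le_anti => //.
  move=> x; apply/esym/eqP; rewrite -subr_eq0; apply/eqP.
  have bC' := proj_bounded (proj_compl pJ').
  apply: (ran_proj_eq0 hM htau x (MXP Mj) bC') => y.
  apply: (pjoin_eq0 hM htau y PM QM (bounded_comp bC' bX)) => z.
    by rewrite /= !fctE -(push_proj_id z MP) (pjoinl hM htau) // subrr.
  by rewrite /= !fctE -(push_proj_id z MQ) (pjoinr hM htau) // subrr.
have bC := proj_bounded (proj_compl pJ).
apply: (pjoin_lub hM htau) => // x; apply/esym/eqP; rewrite -subr_eq0; apply/eqP.
  apply: (ran_proj_eq0 hM htau x (MXP MP) bC) => y.
  have := push_proj_id (P y) Mj; rewrite (pjoinl hM htau) // /push_proj => e.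
  by rewrite /= !fctE e subrr.
apply: (ran_proj_eq0 hM htau x (MXP MQ) bC) => y.
have := push_proj_id (Q y) Mj; rewrite (pjoinr hM htau) // /push_proj => e.
by rewrite /= !fctE e subrr.
Qed.

(** Both sides fix the vectors [x] such that [P] and [Q] fix [X x]. *)
Lemma pull_proj_meet P Q : projections M P -> projections M Q ->
  pull_proj (pmeet P Q) = pmeet (pull_proj P) (pull_proj Q).
Proof.
move=> PM QM; have [[MP pP] [MQ pQ]] := (PM, QM).
have mM := pmeet_proj hM htau PM QM.
have PM' := ker_projP hM htau (MQX MP); have QM' := ker_projP hM htau (MQX MQ).
apply: proj_fix_inj => [||x].
- by case: (ker_projP hM htau (MQX mM.1)).
- by case: (pmeet_proj hM htau PM' QM').
rewrite (pmeet_fix hM htau _ PM' QM') !pull_proj_fix //; last exact: mM.1.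
exact: (pmeet_fix hM htau _ PM QM).
Qed.

Lemma injective_intertwiner_Lat :
  [/\ iso_to_sublattice (Lat M S) (Lat M T),
      iso_to_sublattice (Lat M T) (Lat M S) &
      (Lat M S <> [set (0 : H -> H); (id : H -> H)]) <->
      (Lat M T <> [set (0 : H -> H); (id : H -> H)])].
Proof.
have [sS sT] := (Lat_sublattice MS, Lat_sublattice MT).
have tp P : Lat M S P -> tau (push_proj P) = tau P by move=> /sS.1 /trace_push_proj.
have tq Q : Lat M T Q -> tau (pull_proj Q) = tau Q by move=> /sT.1 /trace_pull_proj.
split.
- apply: (trace_embedding hM htau sS sT.1 push_proj_Lat tp); right=> P Q LP LQ.
  by apply: push_proj_join; exact: sS.1.
- apply: (trace_embedding hM htau sT sS.1 pull_proj_Lat tq); left=> P Q LP LQ.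
  by apply: pull_proj_meet; exact: sT.1.
split; apply: contra_not.
  exact: (trace_trivial hM htau sS push_proj_Lat tp (Lat_0 MS) (Lat_id S)).
exact: (trace_trivial hM htau sT pull_proj_Lat tq (Lat_0 MT) (Lat_id T)).
Qed.

End InvariantSubspaces.

Theorem proposition5p4 (R : realType) (H : hilbertType R)
    (M : set (H -> H)) (hM : type_II1_factor M)
    (tau : (H -> H) -> R[i]) (htau : faithful_normal_trace M tau)
    (S T : H -> H) (hS : M S) (hT : M T)
    (hX : exists X : H -> H,
      [/\ M X, kernel X = [set 0] & X \o S = T \o X]) :
  [/\ iso_to_sublattice (Lat M S) (Lat M T),
      iso_to_sublattice (Lat M T) (Lat M S) &
      (Lat M S <> [set (0 : H -> H); (id : H -> H)]) <->
      (Lat M T <> [set (0 : H -> H); (id : H -> H)])].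
Proof.
have [X [MX kX XS]] := hX.
exact: (injective_intertwiner_Lat (factor_vna (II1_factor hM)) htau hS hT MX kX XS).
Qed.
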